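(* Let $p$ be a prime and let $e\geq 2$ and $d\geq 2$ be integers. Let $\mathcal P(p^e,d)\subset\mathbb R^d$ be the convex hull of all $d$-dimensional vector-factorisations of $p^e$. Then $\mathcal P(p^e,d)$ is the set of $(x_1,\dots,x_d)\in\mathbb R^d$ satisfying the inequalities $$\sum_{i=1}^dx_i\leq (d-1)+p^e,$$ $$x_i\geq 1,\quad i=1,\dots,d,$$ $$\sum_{i=1}^d p^{\alpha_i}x_i\geq\lambda p^{\mu(\alpha)+1}+(d-\lambda)p^{\mu(\alpha)}\quad\text{for all }\alpha=(\alpha_1,\dots,\alpha_d)\in\mathcal R_\lambda(d,e),$$ for all $\lambda\in\{1,\dots,\min(e,d-1)\}$. This list of inequalities is minimal (no inequality can be removed) if $d\geq 3$. For $d=2$, the minimal list is obtained by removing the two inequalities $x_1\geq 1$ and $x_2\geq 1$.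
   Context: $\mathbb N=\{0,1,2,\dots\}$. A $d$-dimensional vector-factorisation of an integer $N\geq1$ is an integral vector $(v_1,\dots,v_d)\in\mathbb N^d$ with $v_1v_2\cdots v_d=N$. For $\lambda\in\{1,\dots,\min(e,d-1)\}$, $\mathcal R_\lambda(d,e)$ (regular vectors of type $\lambda$) is the set of all $\alpha=(\alpha_1,\dots,\alpha_d)\in\mathbb N^d$ such that $\min(\alpha_1,\dots,\alpha_d)=0$, $\max(\alpha_1,\dots,\alpha_d)\, d<e+\sum_{i=1}^d\alpha_i$, and $e+\sum_{i=1}^d\alpha_i\equiv\lambda\pmod d$. For $\alpha\in\mathcal R_\lambda(d,e)$, $\mu(\alpha)$ is the natural integer defined by $\mu(\alpha)d+\lambda=e+\sum_{i=1}^d\alpha_i$, i.e. $\mu(\alpha)=\lfloor (e+\sum_i\alpha_i)/d\rfloor$. *)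

(* Defs.v *)
From HB Require Import structures.
From mathcomp Require Import all_boot all_order all_algebra.
From mathcomp Require Import reals.
Set Implicit Arguments. Unset Strict Implicit. Unset Printing Implicit Defensive.
Import Order.TTheory GRing.Theory Num.Theory.
Local Open Scope ring_scope.

Definition vector_factorisation (d N : nat) (v : {ffun 'I_d -> nat}) : Prop :=
  (\prod_(i < d) v i)%N = N.

Definition natvec (R : realType) (d : nat) (v : {ffun 'I_d -> nat}) : 'rV[R]_d :=
  \row_(i < d) (v i)%:R.

Definition conv_hull (R : realType) (d : nat) (S : 'rV[R]_d -> Prop) (x : 'rV[R]_d) : Prop :=
  exists (n : nat) (w : 'I_n -> R) (y : 'I_n -> 'rV[R]_d),
    (forall k, 0 <= w k) /\ \sum_(k < n) w k = 1 /\
    (forall k, S (y k)) /\ x = \sum_(k < n) w k *: y k.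

Definition factorisation_polytope (R : realType) (N d : nat) : 'rV[R]_d -> Prop :=
  conv_hull (fun x => exists v, vector_factorisation N v /\ x = natvec R v).

Definition regular (d e lam : nat) (a : {ffun 'I_d -> nat}) : Prop :=
  (exists i : 'I_d, a i = 0%N) (* min(a_1..a_d) = 0, entries being natural *)
  /\ ((\max_(i < d) a i) * d < e + \sum_(i < d) a i)%N
  /\ (e + \sum_(i < d) a i = lam %[mod d])%N.

Definition mu (d e : nat) (a : {ffun 'I_d -> nat}) : nat :=
  ((e + \sum_(i < d) a i) %/ d)%N.

Inductive ineq (d : nat) : Type :=
  | ISum
  | IGe1 of 'I_d
  | IReg of nat & {ffun 'I_d -> nat}.

Definition in_list (d e : nat) (I : ineq d) : Prop :=
  match I with
  | ISum => True
  | IGe1 _ => True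
  | IReg lam a => (1 <= lam <= minn e (d - 1))%N /\ regular e lam a
  end.

Definition sat (R : realType) (p e d : nat) (I : ineq d) (x : 'rV[R]_d) : Prop :=
  match I with
  | ISum => \sum_(i < d) x ord0 i <= (d - 1)%:R + (p ^ e)%:R
  | IGe1 i => 1 <= x ord0 i
  | IReg lam a =>
      ((lam * p ^ (mu e a).+1 + (d - lam) * p ^ (mu e a))%N)%:R
        <= \sum_(i < d) (p ^ a i)%:R * x ord0 i
  end.

Definition polyhedron (R : realType) (p e d : nat) (L : ineq d -> Prop) (x : 'rV[R]_d) : Prop :=
  forall I, L I -> sat p e I x.

Definition minimal_list (R : realType) (p e d : nat) (L : ineq d -> Prop) : Prop :=
  forall I, L I ->
    exists x : 'rV[R]_d, polyhedron p e (fun J => L J /\ J <> I) x /\ ~ sat p e I x.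

(* Main.v *)
Require Import Defs.
From HB Require Import structures.
From mathcomp Require Import all_boot all_order all_algebra.
From mathcomp Require Import reals ring lra zify.
Import Order.TTheory GRing.Theory Num.Theory.
Local Open Scope ring_scope.
Set Implicit Arguments. Unset Strict Implicit. Unset Printing Implicit Defensive.

(* Write q = p and let psi be the concave piecewise linear function on [1, oo[ with
   psi(q^k) = k for every natural k; it is the minimum over m of the affine functions
   y |-> m + (y / q^m - 1) / (q - 1).  Multiplying the inequality of a regular vector alpha
   by q^(- mu(alpha)) and putting c = mu(alpha) - alpha turns it into the statement that the
   sum over i of these affine functions with m = c_i, taken at x_i, is at least e; the
   vectors c that occur are exactly those with e - d < sum c < e.  So the polyhedron is
   { x >= 1, sum x <= d - 1 + q^e, sum psi(x_i) >= e }.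
   On the ray from (1, ..., 1) through a point x of the polyhedron, x lies between a point of
   the simplex spanned by the (1, ..., q^e, ..., 1) and the point where some inequality of
   type c becomes tight.  Comparing with neighbouring c shows that this last point is the
   image of a point of a hypersimplex under the affine map
   theta |-> (q^c_i (1 + (q - 1) theta_i))_i, and a hypersimplex is the convex hull of its
   0/1 points, which are mapped to factorisations of p^e. *)

(** * Convexity of hulls and of solution sets *)

Lemma conv_hull_sub (R : realType) (d : nat) (S : 'rV[R]_d -> Prop) x :
  S x -> conv_hull S x.
Proof.
move=> Sx; exists 1%N, (fun=> 1), (fun=> x); split=> //.
by rewrite !big_ord1 scale1r.
Qed.

Lemma conv_hull_convex (R : realType) (d : nat) (S : 'rV[R]_d -> Prop) x y (t : R) :
  0 <= t <= 1 -> conv_hull S x -> conv_hull S y ->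
  conv_hull S (t *: x + (1 - t) *: y).
Proof.
move=> /andP[t0 t1] [n [w [f [w0 [w1 [Sf ->]]]]]] [m [w' [g [w'0 [w'1 [Sg ->]]]]]].
exists (n + m)%N,
  (fun k => match split k with inl i => t * w i | inr j => (1 - t) * w' j end),
  (fun k => match split k with inl i => f i | inr j => g j end).
have sl i : split (lshift m i) = inl i by exact: (unsplitK (inl i)).
have sr j : split (rshift n j) = inr j by exact: (unsplitK (inr j)).
split; first by move=> k; case: (split k) => i; rewrite mulr_ge0 ?subr_ge0.
split.
  rewrite big_split_ord /= (eq_bigr (fun i => t * w i)); last by move=> i _; rewrite sl.
  rewrite (eq_bigr (fun i => (1 - t) * w' i) (r := index_enum 'I_m)); last first.
    by move=> i _; rewrite sr.
  by rewrite -!mulr_sumr w1 w'1; ring.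
split; first by move=> k; case: (split k).
rewrite big_split_ord /= !scaler_sumr; congr (_ + _); apply: eq_bigr => i _.
  by rewrite sl scalerA.
by rewrite sr scalerA.
Qed.

(** Every inequality bounds a linear form, and such bounds pass to convex combinations. Containment
    of the polytope thus has to be checked only at factorisations. *)
Lemma polyhedron_convex (R : realType) (p e d : nat) (L : ineq d -> Prop)
    (S : 'rV[R]_d -> Prop) x :
  (forall y, S y -> polyhedron p e L y) -> conv_hull S x -> polyhedron p e L x.
Proof.
move=> SL [n [w [f [w0 [w1 [Sf ->]]]]]] I LI.
have satf k := SL _ (Sf k) I LI.
have lin (c : 'I_d -> R) : \sum_i c i * (\sum_k w k *: f k) ord0 i
    = \sum_k w k * \sum_i c i * f k ord0 i.
  under eq_bigr => i _ do rewrite summxE mulr_sumr.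
  rewrite exchange_big; apply: eq_bigr => k _; rewrite mulr_sumr.
  by apply: eq_bigr => i _; rewrite !mxE; ring.
have cst (c : R) : c = \sum_k w k * c by rewrite -mulr_suml w1 mul1r.
case: I {LI} satf => [|i|lam a] /= satf.
- rewrite -(eq_bigr _ (fun i _ => mul1r _)) lin [leRHS]cst.
  apply: ler_sum => k _; rewrite ler_wpM2l //.
  by rewrite (eq_bigr _ (fun i _ => mul1r _)).
- rewrite [leLHS]cst summxE; apply: ler_sum => k _; rewrite !mxE ler_wpM2l //.
- by rewrite lin [leLHS]cst; apply: ler_sum => k _; rewrite ler_wpM2l.
Qed.

(** * Hypersimplices as convex hulls of their 0/1 points *)

Definition fractional (R : realType) (t : R) := (t != 0) && (t != 1).

Lemma integral_sum (R : realType) (I : finType) (P : pred I) (f : I -> R) :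
  (forall i, P i -> ~~ fractional (f i)) -> exists n : nat, \sum_(i | P i) f i = n%:R.
Proof.
move=> fP; exists (\sum_(i | P i) (f i == 1%R))%N.
rewrite natr_sum; apply: eq_bigr => i /fP.
by rewrite negb_and !negbK => /orP[]/eqP->; rewrite ?eqxx // eq_sym oner_eq0.
Qed.

(** If [i] were the only fractional index, the other coordinates would sum to an integer n, and
    [lam] would lie strictly between n and n + 1. *)
Lemma second_fractional (R : realType) (d lam : nat) (th : 'I_d -> R) i :
  (forall k, 0 <= th k <= 1) -> \sum_k th k = lam%:R -> fractional (th i) ->
  exists2 j, j != i & fractional (th j).
Proof.
move=> th01 sth fi.
case: (pickP (fun j => (j != i) && fractional (th j))) => [j /andP[]|no]; first by exists j.
have [n nE] : exists n : nat, \sum_(j | j != i) th j = n%:R.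
  by apply: integral_sum => j ji; have := no j; rewrite ji /= => ->.
move: sth; rewrite (bigD1 i) //= nE => E.
have /andP[i0 i1] := th01 i; have /andP[n0 n1] := fi.
have {}i0 : 0 < th i by rewrite lt_def n0.
have {}i1 : th i < 1 by rewrite lt_def eq_sym n1.
have : n%:R < lam%:R :> R by lra.
have : lam%:R < n.+1%:R :> R by rewrite -natr1; lra.
rewrite !ltr_nat; lia.
Qed.

(** The step [s] is the longest move along e_i - e_j that stays in the unit cube, so it ends with
    coordinate i equal to 1 or coordinate j equal to 0. *)
Definition transfer (R : realType) (d : nat) (i j : 'I_d) (th : 'I_d -> R) k : R :=
  let s := Num.min (1 - th i) (th j) in
  th k + s * (k == i)%:R - s * (k == j)%:R.

Lemma transferP (R : realType) (d : nat) (i j : 'I_d) (th : 'I_d -> R) :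
  (forall k, 0 <= th k <= 1) -> i != j -> fractional (th i) -> fractional (th j) ->
  [/\ forall k, 0 <= transfer i j th k <= 1,
      \sum_k transfer i j th k = \sum_k th k &
      (#|[pred k | fractional (transfer i j th k)]| < #|[pred k | fractional (th k)]|)%N].
Proof.
move=> th01 ij fi fj; rewrite /transfer; set s := Num.min _ _.
have /andP[i0 i1] := th01 i; have /andP[j0 j1] := th01 j.
have sP : 0 <= s /\ s <= 1 - th i /\ s <= th j.
  by rewrite /s minEle; case: ifPn; lra.
split.
- move=> k; have [-> | ki] := eqVneq k i.
    by rewrite (negbTE ij) /=; lra.
  have [-> | kj] /= := eqVneq k j; first lra.
  by rewrite !mulr0 subr0 addr0.
- have sd (l : 'I_d) : \sum_k (k == l)%:R = 1 :> R.
    by rewrite (bigD1 l) //= eqxx big1 ?addr0 // => k /negbTE->.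
  by rewrite !big_split sumrN -!mulr_sumr !sd /=; lra.
apply: proper_card; apply/properP; split.
  apply/subsetP => k; rewrite !inE.
  have [-> //| ki] := eqVneq k i.
  have [-> //| kj] /= := eqVneq k j.
  by rewrite !mulr0 subr0 addr0.
have : s = 1 - th i \/ s = th j by rewrite /s minEle; case: ifP; [left|right].
case=> sE; [exists i | exists j]; rewrite ?inE //.
  by rewrite eqxx (negbTE ij) /fractional sE mulr1 mulr0 subr0 addrC subrK eqxx andbF.
by rewrite eqxx (eq_sym j) (negbTE ij) /fractional sE mulr1 mulr0 addr0 subrr eqxx.
Qed.

(** An induction principle, to be applied to convex properties of the image under an affine map. The
    combination is required pointwise because [C] is a predicate on functions. *)
Lemma hypersimplex_ind (R : realType) (d lam : nat) (C : ('I_d -> R) -> Prop) :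
  (forall (f g h : 'I_d -> R) (t : R), 0 <= t <= 1 -> C f -> C g ->
     (forall i, h i = t * f i + (1 - t) * g i) -> C h) ->
  (forall f : 'I_d -> R, (forall i, f i = 0 \/ f i = 1) -> \sum_i f i = lam%:R -> C f) ->
  forall f : 'I_d -> R, (forall i, 0 <= f i <= 1) -> \sum_i f i = lam%:R -> C f.
Proof.
move=> Ccvx Cvert f; move En : #|[pred k | fractional (f k)]| => n.
(* A point with two fractional coordinates lies on a segment in the direction
   e_i - e_j whose ends have fewer fractional coordinates. *)
elim/ltn_ind: n f En => n IH f En f01 sf.
case: (pickP (fun k => fractional (f k))) => [i fi|no]; last first.
  apply: Cvert => // i; have := no i; rewrite /fractional.
  by case: eqVneq => [->|_]; [left|case: eqVneq => [->|//]; right].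
have [j ji fj] := second_fractional f01 sf fi.
have ij : i != j by rewrite eq_sym.
have [a01 sa ca] := transferP f01 ij fi fj.
have [b01 sb cb] := transferP f01 ji fj fi.
rewrite En in ca cb.
have Ca : C (transfer i j f) by apply: (IH _ ca) => //; rewrite sa.
have Cb : C (transfer j i f) by apply: (IH _ cb) => //; rewrite sb.
pose s : R := Num.min (1 - f i) (f j); pose t : R := Num.min (1 - f j) (f i).
have pos (x : 'I_d) : fractional (f x) -> 0 < f x /\ 0 < 1 - f x.
  by move=> /andP[x0 x1]; have := f01 x; rewrite !le_eqVlt eq_sym (negbTE x0) (negbTE x1) /=; lra.
have [fi0 fi1] := pos _ fi; have [fj0 fj1] := pos _ fj.
have s0 : 0 < s by rewrite /s lt_min fi1.
have t0 : 0 < t by rewrite /t lt_min fj1.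
have st0 : 0 < s + t by rewrite addr_gt0.
(* The two ends lie at distances [s] and [t] from [f] in opposite directions, whence the weights t /
   (s + t) and s / (s + t). *)
apply: (Ccvx _ _ f (t / (s + t))) Ca Cb _.
  by rewrite ler_pdivlMr // ler_pdivrMr // mul0r mul1r; lra.
by move=> k; rewrite /transfer -/s -/t; field; rewrite gt_eqF.
Qed.

(** * Chords of psi and their excess at powers of q *)

(* (q - 1) times the affine function taking the value m at q^m and m + 1 at q^(m+1). *)
Definition chord (R : realType) (q : R) (m : nat) (y : R) : R :=
  y / q ^+ m + (q - 1) * m%:R - 1.

Lemma bernoulli (R : realType) (q : R) n : 1 <= q -> 1 + (q - 1) * n%:R <= q ^+ n.
Proof.
move=> q1; elim: n => [|n IH]; first by rewrite expr0; lra.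
have n0 : 0 <= n%:R :> R by [].
rewrite exprS -natr1; set N := n%:R in IH n0 *.
have : q * (1 + (q - 1) * N) <= q * q ^+ n by rewrite ler_wpM2l //; lra.
have : 0 <= (q - 1) * (q - 1) * N by rewrite !mulr_ge0 //; lra.
lra.
Qed.

Lemma chord_pow_above (R : realType) (q : R) n k : 0 < q ->
  chord q n (q ^+ (k + n)) = q ^+ k + (q - 1) * n%:R - 1.
Proof. by move=> q0; rewrite /chord exprD mulfK // expf_neq0 // gt_eqF. Qed.

Lemma chord_pow_below (R : realType) (q : R) n k : 0 < q ->
  chord q (k + n) (q ^+ n) = (q ^+ k)^-1 + (q - 1) * (n%:R + k%:R) - 1.
Proof.
move=> q0; rewrite /chord exprD invfM mulrCA mulfV ?mulr1 ?expf_neq0 ?gt_eqF //.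
by rewrite natrD; ring.
Qed.

(** The worst case is m = n + 1, where the excess over (q - 1) n is (q - 1)^2 / q; this is at least
    (q - 1) / 2 because q >= 2. *)
Lemma chord_pow_lo (R : realType) (q : R) m n : 2 <= q -> (n < m)%N ->
  (q - 1) * (n%:R + 2^-1) <= chord q m (q ^+ n).
Proof.
move=> q2 nm; have q0 : 0 < q by lra.
have [k ->] : exists k, m = (k.+1 + n)%N by exists (m - n).-1; lia.
rewrite chord_pow_below //; case: k => [|k].
  suff : (q - 1) / 2 <= q^-1 + q - 2 by rewrite expr1; lra.
  have -> : q^-1 + q - 2 = (q - 1) * (q - 1) / q by field; lra.
  by rewrite -mulrA ler_wpM2l ?ler_pdivlMr; lra.
have : 0 <= (q ^+ k.+2)^-1 by rewrite invr_ge0 exprn_ge0 // ltW.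
have -> : k.+2%:R = k%:R + 2 :> R by rewrite -addn2 natrD.
have : 0 <= (q - 1) * k%:R by rewrite mulr_ge0 //; lra.
lra.
Qed.

(** The worst case is n = m + 2, where the excess over (q - 1) n is (q - 1)^2, at least q - 1. *)
Lemma chord_pow_hi (R : realType) (q : R) m n : 2 <= q -> (m.+1 < n)%N ->
  (q - 1) * (n%:R + 1) <= chord q m (q ^+ n).
Proof.
move=> q2 nm; have q0 : 0 < q by lra.
have [k ->] : exists k, n = (k.+2 + m)%N by exists (n - m).-2; lia.
rewrite chord_pow_above // natrD.
have -> : k.+2%:R = k%:R + 2 :> R by rewrite -addn2 natrD.
have : 1 + (q - 1) * k%:R <= q ^+ k by apply: bernoulli; lra.
have : 0 <= (q - 1) * k%:R by rewrite mulr_ge0 //; lra.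
rewrite -(addn2 k) exprD; set K := (q - 1) * _; set Q := q ^+ k => K0 QK.
have QK2 : (1 + K) * q ^+ 2 <= Q * q ^+ 2 by rewrite ler_wpM2r // exprn_ge0 // ltW.
have : K * 1 <= K * q ^+ 2 by rewrite ler_wpM2l //; nra.
have -> : (q - 1) * (k%:R + 2 + m%:R + 1) = K + (q - 1) * m%:R + 3 * (q - 1).
  by rewrite /K; ring.
nra.
Qed.

Lemma chord_pow (R : realType) (q : R) m n : 2 <= q ->
  (q - 1) * n%:R <= chord q m (q ^+ n).
Proof.
move=> q2; have [mn|nm] := leqP m n; last first.
  apply: le_trans (chord_pow_lo q2 nm); rewrite ler_wpM2l ?lerDl //; lra.
rewrite -(subnK mn) chord_pow_above; last lra.
rewrite natrD mulrDr; have : 1 + (q - 1) * (n - m)%:R <= q ^+ (n - m).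
  by apply: bernoulli; lra.
lra.
Qed.

Lemma chord_affine (R : realType) (q : R) m a b t :
  chord q m ((1 - t) * a + t * b) = (1 - t) * chord q m a + t * chord q m b.
Proof. by rewrite /chord; ring. Qed.

(** * Regular vectors and their exponent vectors c *)

Definition above (R : realType) (q : R) (e d : nat) (c : 'I_d -> nat) (x : 'rV[R]_d) :=
  (q - 1) * e%:R <= \sum_i chord q (c i) (x ord0 i).

(** The vector c = mu(a) - a. For regular [a] the truncated subtraction is exact, by
    [regular_le_mu]. *)
Definition dual_exponent (e d : nat) (a : {ffun 'I_d -> nat}) (i : 'I_d) : nat :=
  (mu e a - a i)%N.

Lemma regular_mu (e d lam : nat) (a : {ffun 'I_d -> nat}) :
  in_list e (IReg lam a) -> (e + \sum_i a i = mu e a * d + lam)%N.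
Proof.
case=> /andP[lam1]; rewrite leq_min => /andP[_ lamd] [_ [_ eqm]].
rewrite [LHS](divn_eq _ d) eqm; congr (_ + _)%N; apply: modn_small; lia.
Qed.

(** An entry above mu(a) would give max(a) d >= (mu(a) + 1) d, which exceeds e + sum a = mu(a) d +
    lam since lam < d. *)
Lemma regular_le_mu (e d lam : nat) (a : {ffun 'I_d -> nat}) i :
  in_list e (IReg lam a) -> (a i <= mu e a)%N.
Proof.
move=> aL; have := regular_mu aL; case: aL => /andP[lam1].
rewrite leq_min => /andP[_ lamd] [_ [mx _]] eqm.
have am := leq_bigmax_cond (F := a) (P := xpredT) i isT.
rewrite eqm in mx; rewrite leqNgt; apply/negP => lt.
have : ((mu e a).+1 * d <= (\max_(i < d) a i) * d)%N.
  by rewrite leq_mul2r (leq_trans lt am) orbT.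
by move=> {am eqm} /leq_ltn_trans /(_ mx); rewrite mulSn; lia.
Qed.

Lemma sum_dual_exponent (e d lam : nat) (a : {ffun 'I_d -> nat}) :
  in_list e (IReg lam a) -> (\sum_i dual_exponent e a i + lam = e)%N.
Proof.
move=> aL; have eqm := regular_mu aL.
have : (\sum_i dual_exponent e a i + \sum_i a i = mu e a * d)%N.
  rewrite -big_split /= (eq_bigr (fun=> mu e a)) => [|i _].
    by rewrite sum_nat_const card_ord mulnC.
  by rewrite subnK // (regular_le_mu i aL).
by lia.
Qed.

(** The difference of the two sides of [above] is that of the regular inequality divided by q^mu(a);
    the constants agree because c sums to e - lam. *)
Lemma sat_regP (R : realType) (p e d lam : nat) (a : {ffun 'I_d -> nat}) (x : 'rV[R]_d) :
  (0 < p)%N -> in_list e (IReg lam a) ->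
  sat p e (IReg lam a) x <-> above p%:R e (dual_exponent e a) x.
Proof.
move=> p0 aL; have le_mu i := regular_le_mu i aL; have sg := sum_dual_exponent aL.
have lamd : (lam <= d)%N by case: aL => /andP[_]; rewrite leq_min; lia.
rewrite /= /above; set q := p%:R : R; have q0 : 0 < q by rewrite ltr0n.
have qm0 : 0 < q ^+ mu e a by rewrite exprn_gt0.
have -> : \sum_i chord q (dual_exponent e a i) (x ord0 i) =
   (\sum_i (p ^ a i)%:R * x ord0 i) / q ^+ mu e a
    + (q - 1) * (e%:R - lam%:R) - d%:R.
  have -> : e%:R - lam%:R = \sum_i (dual_exponent e a i)%:R :> R.
    by rewrite -[X in X%:R - _]sg natrD addrK natr_sum.
  have -> : d%:R = \sum_(i < d) 1 :> R by rewrite sumr_const card_ord.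
  rewrite mulr_suml mulr_sumr -big_split -sumrB /=; apply: eq_bigr => i _.
  rewrite /chord natrX; congr (_ + _ - _); rewrite -[mu e a in RHS](subnK (le_mu i)) exprD.
  by field; rewrite !gt_eqF ?exprn_gt0.
rewrite natrD !natrM natrX natrX natrB // exprS -/q.
set S := \sum_i _; rewrite -subr_ge0 -[X in _ <-> is_true X]subr_ge0.
have -> : S / q ^+ mu e a + (q - 1) * (e%:R - lam%:R) - d%:R - (q - 1) * e%:R =
  (S - (lam%:R * (q * q ^+ mu e a) + (d%:R - lam%:R) * q ^+ mu e a)) / q ^+ mu e a.
  by field; rewrite gt_eqF.
by rewrite pmulr_lge0 // invr_gt0.
Qed.

(** Taking a = max(c) - c makes min(a) = 0, and lam < d then forces mu(a) = max(c). *)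
Lemma regular_of_exponents (e d lam : nat) (c : 'I_d -> nat) :
  (\sum_i c i + lam = e)%N -> (0 < lam < d)%N ->
  exists2 a, in_list e (IReg lam a) & dual_exponent e a =1 c.
Proof.
move=> sc /andP[lam0 lamd].
pose m := (\max_i c i)%N; pose a := [ffun i => m - c i]%N.
have cm i : (c i <= m)%N by rewrite /m (leq_bigmax_cond (F := c) i isT).
have sa : (e + \sum_i a i = m * d + lam)%N.
  have : (\sum_i a i + \sum_i c i = m * d)%N.
    rewrite -big_split /= (eq_bigr (fun=> m)) => [|i _]; last by rewrite ffunE subnK.
    by rewrite sum_nat_const card_ord mulnC.
  lia.
have muE : mu e a = m.
  by rewrite /mu sa divnMDl ?divn_small ?addn0 //; lia.
exists a; last by move=> i; rewrite /dual_exponent muE ffunE subKn.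
split; first by rewrite lam0 leq_min; lia.
split.
  have [|i mi] := @bigop.eq_bigmax _ c; first by rewrite card_ord; lia.
  by exists i; rewrite ffunE /m mi subnn.
split; last by rewrite sa modnMDl.
rewrite sa; apply: (@leq_ltn_trans (m * d)%N); last lia.
rewrite leq_mul2r; apply/orP; right; apply/bigmax_leqP => i _.
by rewrite ffunE leq_subr.
Qed.

Lemma eq_above (R : realType) (q : R) e d (c c' : 'I_d -> nat) x :
  c =1 c' -> above q e c x -> above q e c' x.
Proof. by move=> cc; rewrite /above (eq_bigr _ (fun i _ => congr1 (chord q ^~ _) (cc i))). Qed.

Lemma all_regP (R : realType) (p e d : nat) (x : 'rV[R]_d) : (0 < p)%N ->
  (forall lam a, in_list e (IReg lam a) -> sat p e (IReg lam a) x) <->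
  (forall c, (\sum_i c i < e < \sum_i c i + d)%N -> above p%:R e c x).
Proof.
move=> p0; split=> [H c /andP[ce ec] | H lam a aL].
  have [a aL ac] := @regular_of_exponents e d (e - \sum_i c i) c ltac:(lia) ltac:(lia).
  by apply: eq_above ac _; apply/(sat_regP _ p0 aL); apply: H.
apply/(sat_regP _ p0 aL); apply: H.
have := sum_dual_exponent aL; case: aL => /andP[l1]; rewrite leq_min; lia.
Qed.

(** * Factorisations satisfy the inequalities *)

Lemma factorisation_exponents (p e d : nat) (v : {ffun 'I_d -> nat}) :
  prime p -> vector_factorisation (p ^ e) v ->
  exists2 b : 'I_d -> nat, forall i, v i = (p ^ b i)%N & (\sum_i b i = e)%N.
Proof.
move=> pp vE; have vb i : v i = (p ^ logn p (v i))%N.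
  have /(dvdn_pfactor _ _ pp)[k _ ->] : (v i %| p ^ e)%N.
    by rewrite -vE (bigD1 i) //= dvdn_mulr.
  by rewrite pfactorK.
exists (fun i => logn p (v i)) => //; apply/eqP.
rewrite -(eqn_exp2l _ _ (prime_gt1 pp)) expn_sum -vE; apply/eqP.
by apply: eq_bigr => i _; rewrite -vb.
Qed.

Lemma exponents_in_polytope (R : realType) (p e d : nat) (b : 'I_d -> nat) :
  (\sum_i b i = e)%N ->
  @factorisation_polytope R (p ^ e) d (\row_i p%:R ^+ b i).
Proof.
move=> be; apply: conv_hull_sub; exists [ffun i => p ^ b i]%N; split.
  by rewrite /vector_factorisation -be expn_sum; apply: eq_bigr => i _; rewrite ffunE.
by apply/rowP => i; rewrite !mxE ffunE natrX.
Qed.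

(** The function b |-> q^b - 1 is superadditive, since (q^b - 1)(q^n - 1) >= 0. *)
Lemma sum_pow_le (R : realType) (q : R) (d : nat) (b : 'I_d -> nat) : 1 <= q ->
  \sum_i (q ^+ b i - 1) <= q ^+ (\sum_i b i)%N - 1.
Proof.
move=> q1; elim/big_rec2: _ => [|i y n _ IH]; first by rewrite expr0 subrr.
have : 0 <= (q ^+ b i - 1) * (q ^+ n - 1).
  by rewrite mulr_ge0 // subr_ge0 exprn_ege1.
by rewrite exprD; nra.
Qed.

Lemma sum_sub1 (R : realType) (d : nat) (f : 'I_d -> R) :
  \sum_i (f i - 1) = \sum_i f i - d%:R.
Proof. by rewrite sumrB sumr_const card_ord. Qed.

Lemma polytope_polyhedron (R : realType) (p e d : nat) (x : 'rV[R]_d) :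
  prime p -> (0 < d)%N ->
  @factorisation_polytope R (p ^ e) d x -> polyhedron p e (@in_list d e) x.
Proof.
move=> pp d0; apply: polyhedron_convex => _ [v [/(factorisation_exponents pp)[b vb be] ->]].
have p2 : 2 <= p%:R :> R by rewrite ler_nat prime_gt1.
case=> [_|i _|lam a aL] /=.
- have := sum_pow_le b (_ : 1 <= p%:R :> R); rewrite sum_sub1 be => /(_ ltac:(lra)).
  under [X in _ -> X <= _]eq_bigr => i _ do rewrite mxE vb natrX.
  by rewrite natrX natrB //; lra.
- by rewrite mxE vb ler1n expn_gt0 prime_gt0.
apply/(sat_regP _ (prime_gt0 pp) aL); rewrite /above -be natr_sum mulr_sumr.
by apply: ler_sum => i _; rewrite mxE vb natrX chord_pow.
Qed.

(** * The upper simplex and the lower facets lie in the polytope *)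

(** The weights (x_k - 1) / (q^e - 1) are the barycentric coordinates of [x] with respect to the
    points (1, ..., q^e, ..., 1). *)
Lemma upper_simplex (R : realType) (p e d : nat) (x : 'rV[R]_d) :
  (1 < p)%N -> (0 < e)%N -> (forall i, 1 <= x ord0 i) ->
  \sum_i (x ord0 i - 1) = p%:R ^+ e - 1 ->
  @factorisation_polytope R (p ^ e) d x.
Proof.
move=> p1 e0 x1 sx; set q := p%:R : R.
have D0 : 0 < q ^+ e - 1 by rewrite subr_gt0 exprn_egt1 ?ltr1n // -lt0n.
exists d, (fun k => (x ord0 k - 1) / (q ^+ e - 1)),
  (fun k => \row_i q ^+ (if i == k then e else 0)%N).
split; first by move=> k; rewrite divr_ge0 ?subr_ge0 // -subr_ge0 ltW.
have w1 : \sum_k (x ord0 k - 1) / (q ^+ e - 1) = 1.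
  by rewrite -mulr_suml sx divff // gt_eqF.
split=> //; split.
  move=> k; exists [ffun i => p ^ (if i == k then e else 0)]%N; split.
    rewrite /vector_factorisation (bigD1 k) //= ffunE eqxx big1 ?muln1 // => i ik.
    by rewrite ffunE (negbTE ik).
  by apply/rowP => i; rewrite !mxE ffunE natrX.
apply/rowP => i; rewrite summxE.
rewrite (eq_bigr (fun k => (x ord0 k - 1) / (q ^+ e - 1) +
          (if k == i then x ord0 k - 1 else 0))); last first.
  move=> k _; rewrite !mxE eq_sym; case: eqP => _; last by rewrite expr0 mulr1 addr0.
  by field; rewrite gt_eqF.
rewrite big_split /= w1 -big_mkcond big_pred1_eq; rewrite [ord0]ord1; lra.
Qed.

Lemma facet_in_polytope (R : realType) (p e d lam : nat) (c : 'I_d -> nat) (th : 'I_d -> R) :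
  (\sum_i c i + lam = e)%N -> (forall i, 0 <= th i <= 1) -> \sum_i th i = lam%:R ->
  @factorisation_polytope R (p ^ e) d (\row_i (p%:R ^+ c i * (1 + (p%:R - 1) * th i))).
Proof.
move=> ce th01 sth; set q := p%:R : R.
pose C (f : 'I_d -> R) :=
  factorisation_polytope (p ^ e) (\row_i (q ^+ c i * (1 + (q - 1) * f i))).
apply: (@hypersimplex_ind _ _ lam C) => // [f g h t t01 Cf Cg hE|f f01 sf].
  rewrite /C; have := conv_hull_convex t01 Cf Cg; congr conv_hull.
  by apply/rowP => i; rewrite !mxE hE; ring.
have fE i : f i = (f i == 1)%:R by case: (f01 i) => ->; rewrite ?eqxx // eq_sym oner_eq0.
rewrite /C; have -> : \row_i (q ^+ c i * (1 + (q - 1) * f i)) = \row_i q ^+ (c i + (f i == 1%R))%N.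
  apply/rowP => i; rewrite !mxE [in LHS]fE exprD; congr (_ * _).
  by case: eqP => _; rewrite /= ?expr0 ?expr1; ring.
apply: exponents_in_polytope; rewrite big_split /= -[RHS]ce; congr (_ + _)%N.
by apply/eqP; rewrite -(eqr_nat R) natr_sum -sf (eq_bigr _ (fun i _ => fE i)).
Qed.

(** * Comparison with neighbouring exponent vectors *)

Definition shift_exponent (d : nat) (c : 'I_d -> nat) (i : 'I_d) (m : nat) (k : 'I_d) : nat :=
  if k == i then m else c k.

Lemma sum_shift (d : nat) (c : 'I_d -> nat) i m :
  (\sum_k shift_exponent c i m k + c i = \sum_k c k + m)%N.
Proof.
rewrite /shift_exponent (bigD1 i) //= eqxx [in RHS](bigD1 i) //=.
rewrite (eq_bigr c); first lia.
by move=> k /negbTE->.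
Qed.

Lemma sum_chord_shift (R : realType) (q : R) (d : nat) (c : 'I_d -> nat) i m (y : 'I_d -> R) :
  \sum_k chord q (shift_exponent c i m k) (y k) =
  \sum_k chord q (c k) (y k) + chord q m (y i) - chord q (c i) (y i).
Proof.
rewrite /shift_exponent (bigD1 i) //= eqxx [in RHS](bigD1 i) //=.
rewrite (eq_bigr (fun k => chord q (c k) (y k))); first lra.
by move=> k /negbTE->.
Qed.

(** Chords m and m + 1 meet at q^(m+1), that is at th = 1. For q > 1, passing to m + 1 lowers the
    value exactly when th > 1. *)
Lemma chord_succ (R : realType) (q : R) m (y th : R) : 0 < q ->
  y = q ^+ m * (1 + (q - 1) * th) ->
  chord q m.+1 y = chord q m y + (q - 1) ^+ 2 / q * (1 - th).
Proof.
move=> q0 ->; rewrite /chord exprS -natr1.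
by field; rewrite !gt_eqF // exprn_gt0.
Qed.

(** Chords m - 1 and m meet at q^m, that is at th = 0. For q > 1, passing to m - 1 lowers the value
    exactly when th < 0. *)
Lemma chord_pred (R : realType) (q : R) m (y th : R) : 0 < q -> (0 < m)%N ->
  y = q ^+ m * (1 + (q - 1) * th) ->
  chord q m.-1 y = chord q m y + (q - 1) ^+ 2 * th.
Proof.
move=> q0; case: m => // m _ ->; rewrite /= /chord exprS -natr1.
by field; rewrite !gt_eqF // exprn_gt0.
Qed.

(** By tightness [c] minimises the sum of chords at [y] among admissible vectors. A coordinate of
    [th] outside [0, 1] would let a neighbour of [c] do better, so [th] lies in a hypersimplex. *)
Lemma lower_boundary (R : realType) (p e d : nat) (c : 'I_d -> nat) (y : 'rV[R]_d) :
  (1 < p)%N -> (forall i, 1 <= y ord0 i) ->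
  (forall c', (\sum_i c' i < e < \sum_i c' i + d)%N -> above p%:R e c' y) ->
  (\sum_i c i < e < \sum_i c i + d)%N ->
  \sum_i chord p%:R (c i) (y ord0 i) = (p%:R - 1) * e%:R ->
  @factorisation_polytope R (p ^ e) d y.
Proof.
move=> p1 y1 reg ce tight; set q := p%:R : R.
have q2 : 2 <= q by rewrite ler_nat.
have q0 : 0 < q by lra.
have q10 : 0 < q - 1 by lra.
have qc0 i : 0 < q ^+ c i by rewrite exprn_gt0.
pose th i := (y ord0 i / q ^+ c i - 1) / (q - 1).
have yE i : y ord0 i = q ^+ c i * (1 + (q - 1) * th i).
  by rewrite /th; field; rewrite !gt_eqF.
have chE i : chord q (c i) (y ord0 i) = (q - 1) * ((c i)%:R + th i).
  by rewrite /chord /th; field; rewrite !gt_eqF.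
pose lam := (e - \sum_i c i)%N.
have ce' : (\sum_i c i + lam = e)%N by rewrite /lam; lia.
have sth : \sum_i th i = lam%:R.
  have : (q - 1) * e%:R = (q - 1) * ((\sum_i c i)%:R + \sum_i th i).
    by rewrite -tight natr_sum -big_split mulr_sumr; apply: eq_bigr => i _; exact: chE.
  by move/(mulfI (lt0r_neq0 q10)); rewrite -ce' natrD; lra.
(* With c_i = 0, a negative th_i would mean y_i < 1; hence c_i can be lowered whenever th_i < 0. *)
have pos i : th i < 0 -> (0 < c i)%N.
  case: (posnP (c i)) => // ci; rewrite /th ci expr0 divr1.
  by rewrite pmulr_llt0 ?invr_gt0 // subr_lt0 ltNge y1.
have step c' : (\sum_i c' i < e < \sum_i c' i + d)%N ->
    \sum_i chord q (c i) (y ord0 i) <= \sum_i chord q (c' i) (y ord0 i).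
  by move/reg; rewrite tight.
have up0 : 0 < (q - 1) ^+ 2 / q by rewrite divr_gt0 // exprn_gt0.
have dn0 : 0 < (q - 1) ^+ 2 by rewrite exprn_gt0.
(* Raising c_i and lowering c_j preserves the sum of [c], so this move is always admissible. *)
have exchange i j : i != j -> 1 < th i -> th j < 0 -> False.
  move=> ij thi thj.
  have cj : (shift_exponent c i (c i).+1 j = c j)%N by rewrite /shift_exponent eq_sym (negbTE ij).
  have := step (shift_exponent (shift_exponent c i (c i).+1) j (c j).-1).
  rewrite !sum_chord_shift cj (chord_succ q0 (yE i)) (chord_pred q0 (pos _ thj) (yE j)).
  have := sum_shift c i (c i).+1; have := sum_shift (shift_exponent c i (c i).+1) j (c j).-1.
  rewrite cj; have := pos _ thj => pj s1 s2 /(_ ltac:(lia)).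
  have : (q - 1) ^+ 2 / q * (1 - th i) < 0 by rewrite pmulr_rlt0 //; lra.
  have : (q - 1) ^+ 2 * th j < 0 by rewrite pmulr_rlt0.
  lra.
have le1 i : th i <= 1.
  rewrite leNgt; apply/negP => thi.
  (* For lam >= 2, raising c_i keeps the sum of [c] below e. For lam = 1 it does not, but then th_i
     > 1 forces another coordinate to be negative and [exchange] applies. *)
  have [lam2|lam1] := leqP 2 lam.
    have := step (shift_exponent c i (c i).+1).
    rewrite sum_chord_shift (chord_succ q0 (yE i)).
    have := sum_shift c i (c i).+1 => s1 /(_ ltac:(lia)).
    have : (q - 1) ^+ 2 / q * (1 - th i) < 0 by rewrite pmulr_rlt0 //; lra.
    lra.
  have [j /andP[ij thj]|no] := pickP (fun j => (i != j) && (th j < 0)).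
    exact: exchange ij thi thj.
  have lamE : lam = 1%N by lia.
  move: sth; rewrite lamE (bigD1 i) //= => sth.
  have : 0 <= \sum_(j | j != i) th j.
    by apply: sumr_ge0 => j ji; have := no j; rewrite eq_sym ji /= => /negbT; rewrite -leNgt.
  lra.
have ge0 j : 0 <= th j.
  rewrite leNgt; apply/negP => thj.
  (* The other coordinates are at most 1 and th_j < 0, so lam < d - 1; this leaves room to lower
     c_j. *)
  have : \sum_(i | i != j) th i <= d%:R - 1.
    have -> : d%:R - 1 = \sum_(i < d | i != j) 1 :> R.
      have -> : d%:R = \sum_(i < d) 1 :> R by rewrite sumr_const card_ord.
      by rewrite [X in X - 1](bigD1 j) //= addrAC subrr add0r.
    by apply: ler_sum.
  move: sth; rewrite (bigD1 j) //= => sth sle.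
  have lamd : lam%:R < d.-1%:R :> R.
    have : d.-1.+1%:R = d%:R :> R by rewrite prednK //; lia.
    by rewrite -natr1; lra.
  rewrite ltr_nat in lamd.
  have := step (shift_exponent c j (c j).-1).
  rewrite sum_chord_shift (chord_pred q0 (pos _ thj) (yE j)).
  have := sum_shift c j (c j).-1; have := pos _ thj => pj s1 /(_ ltac:(lia)).
  have : (q - 1) ^+ 2 * th j < 0 by rewrite pmulr_rlt0.
  lra.
have -> : y = \row_i (q ^+ c i * (1 + (q - 1) * th i)).
  by apply/rowP => i; rewrite mxE -yE.
by apply: facet_in_polytope ce' _ sth => i; rewrite ge0 le1.
Qed.

(** * Rays from (1, ..., 1) and the inclusion of the polyhedron in the polytope *)

Lemma sum_chord_ray (R : realType) (q : R) (d : nat) (c : 'I_d -> nat) (x : 'I_d -> R) (s : R) :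
  \sum_i chord q (c i) (1 + s * (x i - 1)) =
  \sum_i chord q (c i) 1 + s * \sum_i (x i - 1) / q ^+ c i.
Proof.
by rewrite mulr_sumr -big_split; apply: eq_bigr => i _; rewrite /chord /=; ring.
Qed.

Lemma polyhedron_polytope (R : realType) (p e d : nat) (x : 'rV[R]_d) :
  (1 < p)%N -> (0 < e)%N -> (2 <= d)%N ->
  polyhedron p e (@in_list d e) x -> @factorisation_polytope R (p ^ e) d x.
Proof.
move=> p1 e0 d2 xP; set q := p%:R : R.
have q2 : 2 <= q by rewrite ler_nat.
have q0 : 0 < q by lra.
have q10 : 0 < q - 1 by lra.
have x1 i : 1 <= x ord0 i := xP (IGe1 i) I.
have xsum : \sum_i (x ord0 i - 1) <= q ^+ e - 1.
  by rewrite sum_sub1; have := xP (@ISum d) I; rewrite /= natrX natrB ?(ltnW d2) //; lra.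
have reg := (all_regP e x (ltnW p1)).1 (fun lam a => xP (IReg lam a)).
(* Admissible vectors have entries below e, hence form a finite set over which a maximum exists;
   [root c] is the ray parameter at which the inequality of c is tight. *)
pose g (c : {ffun 'I_d -> 'I_e}) i : nat := c i.
pose root (c : 'I_d -> nat) : R :=
  ((q - 1) * e%:R - \sum_i chord q (c i) 1) / \sum_i (x ord0 i - 1) / q ^+ c i.
have chord1 m : chord q m 1 <= (q - 1) * m%:R.
  rewrite /chord mul1r.
  suff : (q ^+ m)^-1 <= 1 by lra.
  by rewrite invf_le1 ?exprn_gt0 // exprn_ege1 //; lra.
have num0 (c : 'I_d -> nat) : (\sum_i c i < e)%N -> 0 < (q - 1) * e%:R - \sum_i chord q (c i) 1.
  rewrite -(ltr_nat R) => ce; rewrite subr_gt0.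
  apply: (@le_lt_trans _ _ ((q - 1) * (\sum_i c i)%:R)); last by rewrite ltr_pM2l.
  by rewrite natr_sum mulr_sumr; apply: ler_sum.
have slope_ge0 (c : 'I_d -> nat) : 0 <= \sum_i (x ord0 i - 1) / q ^+ c i.
  by apply: sumr_ge0 => i _; rewrite divr_ge0 ?subr_ge0 // exprn_ge0 // ltW.
have rayE (c : 'I_d -> nat) s :
    \sum_i chord q (c i) ((\row_i (1 + s * (x ord0 i - 1))) ord0 i) =
    \sum_i chord q (c i) 1 + s * \sum_i (x ord0 i - 1) / q ^+ c i.
  by rewrite -sum_chord_ray; apply: eq_bigr => i _; rewrite mxE.
(* With slope 0 the sum of chords at [x] would equal its value at (1, ..., 1), which is below (q -
   1) e by [num0]. *)
have slope_gt0 c : (\sum_i c i < e < \sum_i c i + d)%N ->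
    0 < \sum_i (x ord0 i - 1) / q ^+ c i.
  move=> ce; rewrite lt_def slope_ge0 andbT; apply/eqP => s0.
  have := reg c ce; rewrite /above.
  have -> : \sum_i chord q (c i) (x ord0 i) = \sum_i chord q (c i) 1.
    have := sum_chord_ray q c (x ord0) 1; rewrite s0 mulr0 addr0 => <-.
    by apply: eq_bigr => i _; rewrite mul1r addrC subrK.
  have := num0 c (proj1 (andP ce)); lra.
pose adm (c : {ffun 'I_d -> 'I_e}) := (\sum_i g c i < e < \sum_i g c i + d)%N.
have finE (c : 'I_d -> nat) : (\sum_i c i < e)%N ->
    exists c' : {ffun 'I_d -> 'I_e}, g c' =1 c.
  move=> ce; have ci i : (c i < e)%N by apply: leq_ltn_trans ce; rewrite (bigD1 i) //= leq_addr.
  by exists [ffun i => Ordinal (ci i)] => i; rewrite /g ffunE.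
(* The vector (e - 1, 0, ..., 0) is admissible because d >= 2. *)
have [c0 c0P] : exists c0, adm c0.
  pose i0 : 'I_d := Ordinal (ltnW d2).
  have sc : (\sum_i (if i == i0 then e.-1 else 0) = e.-1)%N.
    by rewrite (bigD1 i0) //= big1 ?addn0 // => i /negbTE->.
  have [|c0 c0E] := finE (fun i => if i == i0 then e.-1 else 0)%N; first by rewrite sc; lia.
  by exists c0; rewrite /adm (eq_bigr _ (fun i _ => c0E i)) sc; lia.
(* At the largest root all regular inequalities hold and that of [c] is tight: the ray enters the
   region there. *)
case: (@arg_maxP _ _ _ c0 adm (fun c => root (g c)) c0P) => c cP cmax.
pose s := root (g c).
have sl0 := slope_gt0 _ cP.
have s0 : 0 < s by rewrite divr_gt0 // num0 // (proj1 (andP cP)).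
have s1 : s <= 1.
  rewrite ler_pdivrMr // lerBlDl -(sum_chord_ray q (g c) (x ord0) 1).
  have := reg _ cP; rewrite /above => /le_trans; apply.
  by apply: ler_sum => i _; rewrite mul1r addrC subrK.
pose y := \row_i (1 + s * (x ord0 i - 1)).
have yP : @factorisation_polytope R (p ^ e) d y.
  apply: (@lower_boundary _ _ _ _ (g c)) => //.
  - by move=> i; rewrite mxE lerDl mulr_ge0 ?subr_ge0 // ltW.
  - move=> c' c'P; have [c'' c''E] := finE c' (proj1 (andP c'P)).
    have adm'' : adm c'' by rewrite /adm (eq_bigr _ (fun i _ => c''E i)).
    apply: eq_above c''E _; have sl := slope_gt0 _ adm''.
    have := cmax _ adm''; rewrite /above rayE /= ler_pdivrMr // -/s -/q; lra.
  - by rewrite rayE /s /root divfK ?gt_eqF // addrC subrK.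
(* For s = 1 the parameter [u] below may be 1 as well, and the weight [t] would have denominator
   0. *)
have [sE1|sN1] := eqVneq s 1.
  by move: yP; congr factorisation_polytope; apply/rowP => i; rewrite mxE sE1 mul1r addrC subrK.
have {}s1 : s < 1 by rewrite lt_def eq_sym sN1.
pose T := \sum_i (x ord0 i - 1).
have T0 : 0 < T.
  rewrite lt_def sumr_ge0 ?andbT => [|i _]; last by rewrite subr_ge0.
  apply/eqP => TE; move: sl0; rewrite big1 ?ltxx // => i _.
  by rewrite (psumr_eq0P _ TE) ?mul0r // => k _; rewrite subr_ge0.
pose u := (q ^+ e - 1) / T.
have u1 : 1 <= u by rewrite ler_pdivlMr // mul1r.
pose z := \row_i (1 + u * (x ord0 i - 1)).
have zP : @factorisation_polytope R (p ^ e) d z.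
  apply: upper_simplex => //.
    by move=> i; rewrite mxE lerDl mulr_ge0 ?subr_ge0 //; lra.
  rewrite (eq_bigr (fun i => u * (x ord0 i - 1))) => [|i _]; last by rewrite mxE addrC addKr.
  by rewrite -mulr_sumr divfK // gt_eqF.
(* Chosen so that t s + (1 - t) u = 1, the parameter of [x] on the ray. *)
pose t := (u - 1) / (u - s).
have us : 0 < u - s by lra.
have t01 : 0 <= t <= 1 by rewrite /t divr_ge0 ?ler_pdivrMr //=; lra.
have := conv_hull_convex t01 yP zP; congr conv_hull.
apply/rowP => i; rewrite !mxE /t [RHS](_ : _ = 1 + (x ord0 i - 1)); last by ring.
field; rewrite gt_eqF //.
Qed.

(** * Dimension two: the bounds x_i >= 1 follow from the others *)

Lemma dim2_ge1 (R : realType) (p e : nat) (x : 'rV[R]_2) :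
  (1 < p)%N -> (2 <= e)%N ->
  polyhedron p e (fun I => in_list e I /\ forall i, I <> IGe1 i) x ->
  forall i, 1 <= x ord0 i.
Proof.
move=> p1 e2 xP i; set q := p%:R : R.
have q2 : 2 <= q by rewrite ler_nat.
have q0 : 0 < q by lra.
have reg : forall c, (\sum_i c i < e < \sum_i c i + 2)%N -> above q e c x.
  by apply/(all_regP e x (ltnW p1)) => lam a aL; apply: xP.
(* The inequality of c = (0, e - 1) combined with the upper bound on the sum. *)
have [j ij two] : exists2 j : 'I_2, j != i & forall (V : nmodType) (F : 'I_2 -> V),
    \sum_k F k = F i + F j.
  exists (rev_ord i) => [|V F].
    by rewrite -val_eqE /=; case: i => [[|[|]]].
  rewrite (bigD1 i) //= (big_pred1 (rev_ord i)) // => k; rewrite /= -!val_eqE /=.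
  by case: i k => [[|[|]] //] ? [[|[|]]].
have := xP (@ISum 2) ltac:(by []); rewrite /= two natrX -/q subSnn => xs.
have := reg (fun k => if k == i then 0 else e.-1)%N.
have twoN (F : 'I_2 -> nat) : (\sum_k F k = F i + F j)%N by exact: two.
rewrite /above !twoN two eqxx (negbTE ij) => /(_ ltac:(lia)).
have -> : e%:R = e.-1%:R + 1 :> R by rewrite natr1 prednK //; lia.
have eE : q ^+ e = q * q ^+ e.-1 by rewrite -exprS prednK //; lia.
have Q1 : 1 < q ^+ e.-1 by rewrite exprn_egt1 ?(lt_le_trans _ q2) ?ltr1n //; lia.
rewrite /chord expr0 divr1 mulr0 addr0 eE in xs *; set Q := q ^+ e.-1 in xs Q1 *.
set xi := x ord0 i in xs *; set xj := x ord0 j in xs *.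
(* Multiplied by Q and combined with xi + xj <= 1 + q Q, this leaves (Q - 1)(xi - 1) >= 0, where Q >
   1 because e >= 2. *)
move=> H; have {}H : (q + 1 - xi) <= xj / Q by lra.
rewrite ler_pdivlMr in H; last lra.
have : 0 <= (Q - 1) * (xi - 1) by lra.
by rewrite pmulr_rge0 ?subr_gt0 ?subr_ge0.
Qed.

(** * Irredundancy: points violating a single inequality *)

Lemma sum_const_ord (R : realType) (d : nat) (c : R) : \sum_(i < d) c = d%:R * c.
Proof. by rewrite sumr_const card_ord mulr_natl. Qed.

Lemma ISum_irredundant (R : realType) (p e d : nat) :
  (1 < p)%N -> (0 < e)%N -> (2 <= d)%N ->
  exists x : 'rV[R]_d,
    polyhedron p e (fun J => in_list e J /\ J <> ISum d) x /\ ~ sat p e (ISum d) x.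
Proof.
move=> p1 e0 d2; set q := p%:R : R.
have q2 : 2 <= q by rewrite ler_nat.
have Q1 : 1 < q ^+ e by rewrite exprn_egt1 ?(lt_le_trans _ q2) ?ltr1n // -lt0n.
(* Each coordinate q^e alone contributes at least (q - 1) e to any regular inequality, while the sum
   d q^e is too large. *)
exists (\row_i q ^+ e); split; last first.
  rewrite /= (eq_bigr (fun=> q ^+ e)) => [|i _]; last by rewrite mxE.
  rewrite sum_const_ord natrX natrB ?(ltnW d2) // -/q; apply/negP; rewrite -ltNge.
  have d2' : 2 <= d%:R :> R by rewrite ler_nat.
  have : 0 < (d%:R - 1) * (q ^+ e - 1) by rewrite mulr_gt0; lra.
  lra.
case=> [[_ /(_ erefl)] //|i _|lam a [aL _]] /=; first by rewrite mxE ltW.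
apply/(sat_regP _ (ltnW p1) aL); rewrite /above.
apply: le_trans (_ : \sum_(i < d) (q - 1) * e%:R <= _); last first.
  by apply: ler_sum => i _; rewrite mxE chord_pow.
rewrite sum_const_ord ler_peMl ?ler1n ?(ltnW d2) // mulr_ge0 //; lra.
Qed.

(** The point divides [q^n, q^(n+1)] with weight t. A chord m other than n has excess at least q - 1
    at q^(n+1) if m < n, and at least (q - 1) / 2 at q^n if m > n; the bounds on [eps] fit these two
    cases. *)
Lemma chord_interior (R : realType) (q t eps : R) (m n : nat) :
  2 <= q -> 0 <= eps <= t -> 2 * eps <= 1 - t -> m != n ->
  (q - 1) * (n%:R + t + eps) <= chord q m (q ^+ n * (1 + (q - 1) * t)).
Proof.
move=> q2 /andP[e0 et] et1 mn.
have -> : q ^+ n * (1 + (q - 1) * t) = (1 - t) * q ^+ n + t * q ^+ n.+1.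
  by rewrite exprS; ring.
rewrite chord_affine.
have t1 : 0 <= 1 - t by lra.
have t0 : 0 <= t by lra.
have lo := chord_pow m n q2; have hi := chord_pow m n.+1 q2.
have bnd u v : u <= chord q m (q ^+ n) -> v <= chord q m (q ^+ n.+1) ->
    (1 - t) * u + t * v <= (1 - t) * chord q m (q ^+ n) + t * chord q m (q ^+ n.+1).
  by move=> ? ?; rewrite lerD // ler_wpM2l.
move: mn; rewrite neq_ltn => /orP[mn|nm].
  have /bnd := chord_pow_hi q2 (mn : (m.+1 < n.+1)%N).
  move=> /(_ _ lo); apply: le_trans.
  rewrite -(natr1 n); suff : 0 <= (q - 1) * (t - eps) by lra.
  by rewrite mulr_ge0; lra.
have /bnd := chord_pow_lo q2 nm; move=> /(_ _ hi); apply: le_trans.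
rewrite -(natr1 n); suff : 0 <= (q - 1) * ((1 - t) / 2 - eps) by lra.
by rewrite mulr_ge0; lra.
Qed.

(** The vector c determines lam = e - sum c and, because min(a) = 0, also mu(a) = max(c); then a =
    mu(a) - c. *)
Lemma dual_exponent_inj (e d lam lam' : nat) (a a' : {ffun 'I_d -> nat}) :
  in_list e (IReg lam a) -> in_list e (IReg lam' a') ->
  dual_exponent e a =1 dual_exponent e a' -> IReg lam a = IReg lam' a'.
Proof.
move=> aL aL' aa; have s := sum_dual_exponent aL; have s' := sum_dual_exponent aL'.
rewrite (eq_bigr _ (fun i _ => aa i)) in s.
have -> : lam = lam' by apply: (addnI (etrans s (esym s'))).
suff muE : mu e a = mu e a'.
  congr IReg; apply/ffunP => i.
  rewrite -(subKn (regular_le_mu i aL)) -(subKn (regular_le_mu i aL')) -muE; congr (_ - _)%N.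
  by have := aa i; rewrite /dual_exponent -muE.
case: (aL) => _ [[i ai] _]; case: (aL') => _ [[j aj] _].
have := aa i; have := aa j; rewrite /dual_exponent ai aj !subn0 => ej ei.
by apply/eqP; rewrite eqn_leq {1}ei leq_subr -ej leq_subr.
Qed.

Lemma IReg_irredundant (R : realType) (p e d lam : nat) (a : {ffun 'I_d -> nat}) :
  prime p -> (2 <= d)%N -> in_list e (IReg lam a) ->
  exists x : 'rV[R]_d,
    polyhedron p e (fun J => in_list e J /\ J <> IReg lam a) x /\ ~ sat p e (IReg lam a) x.
Proof.
move=> pp d2 aL; set q := p%:R : R; have p0 := prime_gt0 pp.
have q2 : 2 <= q by rewrite ler_nat prime_gt1.
have d2' : 2 <= d%:R :> R by rewrite ler_nat.
have lam1 : 1 <= lam%:R :> R by rewrite ler1n; case: aL => /andP[].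
have lamd : lam%:R <= d%:R - 1 :> R.
  rewrite lerBrDr natr1 ler_nat; case: aL => /andP[l1]; rewrite leq_min; lia.
pose c := dual_exponent e a.
(* As 1 <= lam <= d - 1, the value 1 / (2 d) gives eps <= tau and 2 eps <= 1 - tau, which
   [chord_interior] requires. *)
pose eps : R := (2 * d%:R)^-1; pose tau := (lam%:R - eps) / d%:R.
pose pt (t : R) : 'rV[R]_d := \row_i (q ^+ c i * (1 + (q - 1) * t)).
have epsE : eps * (2 * d%:R) = 1 by rewrite mulVf //; lra.
have eps0 : 0 < eps by rewrite invr_gt0; lra.
have eps2 : eps <= 4^-1 by rewrite lef_pV2 ?posrE; lra.
have tauE : d%:R * tau = lam%:R - eps by rewrite /tau mulrC divfK //; lra.
have d0 : 0 < d%:R :> R by lra.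
have tau_ge : eps <= tau by rewrite -(ler_pM2l d0) tauE; lra.
have tau_le : 2 * eps <= 1 - tau by rewrite -(ler_pM2l d0) mulrBr tauE; lra.
have sumc : (\sum_i c i)%:R + lam%:R = e%:R :> R by rewrite -natrD sum_dual_exponent.
have sumE : \sum_i (q - 1) * ((c i)%:R + tau) = (q - 1) * (e%:R - eps).
  by rewrite -mulr_sumr big_split /= sum_const_ord tauE -natr_sum -sumc; congr (_ * _); ring.
have q10 : 0 < q - 1 by lra.
(* tau = lam / d would give the barycentre of the facet; eps pushes it slightly outside. *)
exists (pt tau); split; last first.
  move/(sat_regP _ p0 aL); rewrite /above -/q -/c.
  rewrite (eq_bigr (fun i => (q - 1) * ((c i)%:R + tau))) => [|i _].
    by rewrite sumE ler_pM2l //; lra.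
  by rewrite mxE /chord; field; rewrite gt_eqF // exprn_gt0 //; lra.
case=> [_|i _|lam' a' [aL' neq]].
(* Moving from the barycentre, which lies in the polytope, to [tau] only lowers the sum. *)
- have : polyhedron p e (@in_list d e) (pt (lam%:R / d%:R)).
    apply: polytope_polyhedron => //; first lia.
    apply: (@facet_in_polytope _ _ _ _ lam); first exact: sum_dual_exponent.
      by move=> _; rewrite divr_ge0 //= ler_pdivrMr //; lra.
    by rewrite sum_const_ord mulrC divfK // gt_eqF.
  move=> /(_ (ISum d) I) /=; apply: le_trans; apply: ler_sum => i _; rewrite !mxE.
  rewrite ler_wpM2l ?lerD2l //; first by rewrite exprn_ge0 //; lra.
  by rewrite ler_pM2l // -(ler_pM2l d0) tauE [leRHS]mulrC divfK ?gt_eqF //; lra.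
- rewrite /= mxE; have : 1 <= q ^+ c i by rewrite exprn_ege1 //; lra.
  move=> c1; have : 0 <= (q - 1) * tau by rewrite mulr_ge0; lra.
  move=> t0; rewrite -[leLHS]mulr1; apply: ler_pM => //; lra.
apply/(sat_regP _ p0 aL'); set c' := dual_exponent e a'.
(* At an index where c' differs from c the chord gains (q - 1) eps, exactly the deficit in
   [sumE]. *)
have [k ck] : exists k, c' k != c k.
  apply/existsP; apply: contra_notT neq; rewrite negb_exists => /forallP cc.
  by apply: (dual_exponent_inj aL' aL) => i; apply/eqP; rewrite -[_ == _]negbK cc.
have lek i : (q - 1) * ((c i)%:R + tau) <= chord q (c' i) (pt tau ord0 i).
  rewrite mxE; have [->|ci] := eqVneq (c' i) (c i).
    rewrite le_eqVlt; apply/orP; left; apply/eqP.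
    by rewrite /chord; field; rewrite gt_eqF // exprn_gt0 //; lra.
  apply: le_trans (chord_interior q2 (_ : 0 <= eps <= tau) tau_le ci); last lra.
  by rewrite ler_pM2l //; lra.
rewrite /above -/q (bigD1 k) //=.
apply: le_trans (_ : (q - 1) * ((c k)%:R + tau + eps) +
          \sum_(i < d | i != k) (q - 1) * ((c i)%:R + tau) <= _); last first.
  apply: lerD; last by apply: ler_sum.
  by rewrite mxE; apply: chord_interior => //; lra.
move: sumE; rewrite (bigD1 k) //= => /(canRL (addKr _)) ->.
by rewrite le_eqVlt; apply/orP; left; apply/eqP; ring.
Qed.

(** Chords increase, and 2 q - 1 divides [q, q^2] with weight 1 / q; so the value is at least (q -
    1)(1 + 1 / q), and (q - 1) / q >= 1/2. *)
Lemma chord_mid (R : realType) (q y : R) (m : nat) : 2 <= q -> 2 * q - 1 <= y ->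
  (q - 1) + 2^-1 <= chord q m y.
Proof.
move=> q2 qy; have q0 : 0 < q by lra.
have : chord q m (2 * q - 1) <= chord q m y.
  by rewrite /chord !lerD2r ler_pM2r // invr_gt0 exprn_gt0.
apply: le_trans.
have -> : 2 * q - 1 = (1 - q^-1) * q ^+ 1 + q^-1 * q ^+ 2 by field; rewrite gt_eqF.
rewrite chord_affine.
have qV : 0 < q^-1 by rewrite invr_gt0.
have qV2 : q^-1 <= 2^-1 by rewrite lef_pV2 ?posrE.
have : (1 - q^-1) * ((q - 1) * 1%:R) <= (1 - q^-1) * chord q m (q ^+ 1).
  by rewrite ler_wpM2l ?chord_pow //; lra.
have : q^-1 * ((q - 1) * 2%:R) <= q^-1 * chord q m (q ^+ 2).
  by rewrite ler_wpM2l ?chord_pow //; lra.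
have qq : q^-1 * q = 1 by rewrite mulVf // gt_eqF.
nra.
Qed.

Lemma IGe1_irredundant (R : realType) (p e d : nat) (i : 'I_d) :
  (1 < p)%N -> (2 <= e)%N -> (3 <= d)%N ->
  exists x : 'rV[R]_d,
    polyhedron p e (fun J => in_list e J /\ J <> IGe1 i) x /\ ~ sat p e (IGe1 i) x.
Proof.
move=> p1 e2 d3; set q := p%:R : R.
have q2 : 2 <= q by rewrite ler_nat.
have [j ji] : exists j, j != i.
  exists (if i == Ordinal (leq_trans (isT : 0 < 3)%N d3) then Ordinal (leq_trans (isT : 1 < 3)%N d3)
          else Ordinal (leq_trans (isT : 0 < 3)%N d3)).
  by case: ifP => [/eqP->|/negbT]; rewrite // eq_sym.
have [k /andP[ki kj]] : exists k, (k != i) && (k != j).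
  have : (0 < #|~: [set i; j]|)%N.
    rewrite cardsCs setCK card_ord cards2; case: eqP => _; lia.
  by case/card_gt0P => k; rewrite !inE negb_or; exists k.
have split3 (V : nmodType) (F : 'I_d -> V) : \sum_l F l =
    F i + (F j + (F k + \sum_(l | (l != i) && (l != j) && (l != k)) F l)).
  rewrite (bigD1 i) //= (bigD1 j) //=; congr (_ + (_ + _)).
  by rewrite (bigD1 k) ?ki ?kj.
have Q1 : 1 <= q ^+ e.-1 by rewrite exprn_ege1 //; lra.
have Qq : q <= q ^+ e.-1.
  by rewrite -[leLHS]expr1 ler_weXn2l //; [lra | lia].
have QE : q ^+ e = q * q ^+ e.-1 by rewrite -exprS prednK //; lia.
have yk : 2 * q - 1 <= q ^+ e + 1 - q ^+ e.-1.
  have : 0 <= (q - 1) * (q ^+ e.-1 - q) by rewrite mulr_ge0; lra.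
  have : 0 <= (q - 2) * (q - 1) by rewrite mulr_ge0; lra.
  by rewrite QE; nra.
(* Lowering x_i to 1/2 costs at most 1/2 in the sum of chords. Here x_j contributes (q - 1)(e - 1)
   and x_k >= 2 q - 1 contributes q - 1 plus the missing 1/2; three distinct indices exist since d
   >= 3. *)
pose x : 'rV[R]_d := \row_l (if l == i then 2^-1 else if l == j then q ^+ e.-1
   else if l == k then q ^+ e + 1 - q ^+ e.-1 else 1).
have xi : x ord0 i = 2^-1 by rewrite mxE eqxx.
have xj : x ord0 j = q ^+ e.-1 by rewrite mxE (negbTE ji) eqxx.
have xk : x ord0 k = q ^+ e + 1 - q ^+ e.-1 by rewrite mxE (negbTE ki) (negbTE kj) eqxx.
have xl l : (l != i) && (l != j) && (l != k) -> x ord0 l = 1.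
  by case/andP=> /andP[/negbTE li /negbTE lj] /negbTE lk; rewrite mxE li lj lk.
have chord1 m : 0 <= chord q m 1.
  by have := chord_pow m 0 q2; rewrite mulr0 expr0.
exists x; split; last by rewrite /= xi; lra.
case=> [_|l [_ li]|lam a [aL _]].
- rewrite /= split3 xi xj xk natrX natrB; last lia.
  have -> : \sum_(l | (l != i) && (l != j) && (l != k)) x ord0 l = d%:R - 3.
    rewrite (eq_bigr _ xl); have := split3 R (fun=> 1); rewrite sum_const_ord mulr1 => ->.
    ring.
  rewrite -/q; lra.
- have {}li : l != i by apply/eqP => li'; apply: li; rewrite li'.
  rewrite /= mxE (negbTE li); case: ifP => // _; case: ifP => // _; lra.
apply/(sat_regP _ (ltnW p1) aL); rewrite /above -/q split3 xi xj xk.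
have : 0 <= \sum_(l | (l != i) && (l != j) && (l != k)) chord q (dual_exponent e a l) (x ord0 l).
  by apply: sumr_ge0 => l /xl ->.
have := chord_mid (dual_exponent e a k) q2 yk.
have := chord_pow (dual_exponent e a j) e.-1 q2.
have -> : e%:R = e.-1%:R + 1 :> R by rewrite natr1 prednK //; lia.
(* Replacing the argument 1 by 1/2 lowers chord m by 1 / (2 q^m), at most 1/2. *)
have : - 2^-1 <= chord q (dual_exponent e a i) 2^-1.
  set m := dual_exponent e a i; have := chord1 m; rewrite /chord.
  have : 1 / q ^+ m <= 1 by rewrite ler_pdivrMr ?exprn_gt0 ?mul1r ?exprn_ege1 //; lra.
  set u := _ / _; have -> : 2^-1 / q ^+ m = u / 2 by rewrite /u mul1r mulrC.
  lra.
lra.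
Qed.

Theorem theorem1p1 (R : realType) (p e d : nat) :
  prime p -> (2 <= e)%N -> (2 <= d)%N ->
  (forall x : 'rV[R]_d,
     @factorisation_polytope R (p ^ e) d x <-> @polyhedron R p e d (@in_list d e) x)
  /\ ((3 <= d)%N -> @minimal_list R p e d (@in_list d e))
  /\ (d = 2%N ->
        (forall x : 'rV[R]_d,
           @factorisation_polytope R (p ^ e) d x <->
           @polyhedron R p e d (fun I => @in_list d e I /\ forall i, I <> IGe1 i) x)
        /\ @minimal_list R p e d (fun I => @in_list d e I /\ forall i, I <> IGe1 i)).
Proof.
move=> pp e2 d2; have p1 := prime_gt1 pp; have e0 := ltnW e2.
have hullE x : @factorisation_polytope R (p ^ e) d x <-> @polyhedron R p e d (@in_list d e) x.
  by split; [apply: polytope_polyhedron (ltnW d2) | apply: polyhedron_polytope].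
split=> //; split=> [d3 [|i|lam a] IL|dE].
- exact: ISum_irredundant.
- exact: IGe1_irredundant.
- exact: IReg_irredundant.
split=> [x|].
  split=> [/hullE xP I [IL _]|xP]; first exact: xP.
  apply/hullE; have x1 : forall i, 1 <= x ord0 i by subst d; exact: dim2_ge1 xP.
  by case=> [|i|lam a] IL //; [apply: (xP (ISum d)) | apply: x1 | apply: (xP (IReg lam a))].
(* A point that satisfies all other inequalities of the full list also satisfies those of the
   shorter list. *)
have weaken I : (exists x : 'rV[R]_d,
    polyhedron p e (fun J => in_list e J /\ J <> I) x /\ ~ sat p e I x) ->
  exists x : 'rV[R]_d,
    polyhedron p e (fun J => (in_list e J /\ forall i, J <> IGe1 i) /\ J <> I) x /\ ~ sat p e I x.
  by move=> [x [xP xI]]; exists x; split=> // J [[JL _] JI]; apply: xP.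
move=> [|i|lam a] [IL notGe1]; last 1 first.
- exact/weaken/IReg_irredundant.
- exact/weaken/ISum_irredundant.
- by case: (notGe1 i).
Qed.
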